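(* Let $F$ be a forest with at least one edge, let $\langle A,B\rangle$ be an annihilating decomposition of $F$, and put $x=a(F)-\alpha(F)$. If $$x=\frac{\mu(F)-1}{2},$$ then $\mu(F)$ is odd and all inequalities in the chain $x\leq e(A)\leq e(B)\leq |B|-1$ are equalities, that is, $$x=e(A)=e(B)=|B|-1;$$ moreover $F[B]$ is a tree, and $F[A]$ is a matching of size $x$ together with isolated vertices (i.e. $F[A]$ is a disjoint union of $x$ copies of $K_2$ and some number, possibly zero, of isolated vertices).
   Context: All graphs are finite, simple and undirected. For a graph $G$, $m(G)$ is the number of edges, $\alpha(G)$ is the independence number, $\mu(G)$ is the matching number, $G[X]$ is the subgraph induced by $X\subseteq V(G)$, and $e(X)$ is the number of edges of $G[X]$. A set $A\subseteq V(G)$ is annihilating if $\sum_{v\in A}d(v)\leq m(G)$; the annihilation number $a(G)$ is the maximum size of an annihilating set (equivalently, with degree sequence $d_1\leq\cdots\leq d_n$, $a(G)=\max\{k:\sum_{i=1}^k d_i\leq m(G)\}$). An annihilating decomposition of $G$ is a partition $\langle A,B\rangle$ of $V(G)$ such that $A$ is a maximum annihilating set (so $|A|=a(G)$) and $B=V(G)\setminus A$. *)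

(* Defs.v *)
From mathcomp Require Import all_boot.

Set Implicit Arguments.
Unset Strict Implicit.
Unset Printing Implicit Defensive.

Record sgraph := SGraph {
  vertex :> finType;
  adj : rel vertex;
  adj_sym : symmetric adj;
  adj_irr : irreflexive adj }.

Section Invariants.
Variable G : sgraph.
Implicit Types (u v : G) (A B S : {set G}) (M : {set {set G}}).

Definition edges : {set {set G}} :=
  [set [set p.1; p.2] | p in [pred p : G * G | adj p.1 p.2]].

Definition num_edges : nat := #|edges|.

Definition degree v : nat := #|[set u | adj v u]|.

Definition independent S : bool :=
  [forall u in S, forall v in S, ~~ adj u v].

Definition independence_number : nat := \max_(S | independent S) #|S|.

Definition is_matching M : bool := (M \subset edges) && trivIset M.

Definition matching_number : nat := \max_(M | is_matching M) #|M|.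

Definition annihilating A : bool := \sum_(v in A) degree v <= num_edges.

Definition annihilation_number : nat := \max_(A | annihilating A) #|A|.

Definition annihilating_decomposition A B : Prop :=
  [/\ annihilating A, #|A| = annihilation_number & B = ~: A].

(* A closed walk u, v, u along a single edge is a [ucycle] of size 2; the
   cycles of a simple graph are those of size at least 3. *)
Definition is_forest : Prop :=
  forall c : seq G, 2 < size c -> ~ ucycle (@adj G) c.

Definition is_connected : Prop :=
  0 < #|G| /\ forall u v, connect (@adj G) u v.

Definition is_tree : Prop := is_connected /\ is_forest.

Section Induced.
Variable X : {set G}.

Definition induced_adj : rel {v : G | v \in X} :=
  fun a b => adj (val a) (val b).

Lemma induced_adj_sym : symmetric induced_adj.
Proof. by move=> a b; apply: adj_sym. Qed.

Lemma induced_adj_irr : irreflexive induced_adj.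
Proof. by move=> a; apply: adj_irr. Qed.

Definition induced : sgraph := SGraph induced_adj_sym induced_adj_irr.

End Induced.

End Invariants.

Definition edges_in (G : sgraph) (X : {set G}) : nat :=
  num_edges (induced X).

Definition isomorphic (G H : sgraph) : Prop :=
  exists2 f : G -> H, bijective f & forall u v, adj (f u) (f v) = adj u v.

Section MatchingGraph.
Variables k n : nat.

Definition matching_graph_adj : rel ('I_k * bool + 'I_n) :=
  fun u v => match u, v with
  | inl (i, b), inl (j, c) => (i == j) && (b != c)
  | _, _ => false
  end.

Lemma matching_graph_adj_sym : symmetric matching_graph_adj.
Proof.
by move=> [[i b]|i] [[j c]|j] //=; rewrite (eq_sym i) (eq_sym b).
Qed.

Lemma matching_graph_adj_irr : irreflexive matching_graph_adj.
Proof. by move=> [[i b]|i] //=; rewrite !eqxx. Qed.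

(* k disjoint copies of K_2, the i-th one on the vertices (i, false) and
   (i, true), together with n isolated vertices. *)
Definition matching_graph : sgraph :=
  SGraph matching_graph_adj_sym matching_graph_adj_irr.

End MatchingGraph.

(* Main.v *)
(** Let [e(X)] count the edges inside [X].  Deleting one endpoint of every edge
    inside [A] leaves an independent set, so [a - alpha <= e(A)].  Counting the
    pairs (vertex of [A], incident edge) turns the annihilation inequality into
    [e(A) <= e(B)], and [e(B) <= |B| - 1] in a forest.  A leaf argument gives
    [|V| <= alpha + mu], so the hypothesis [2 x = mu - 1] forces [|B| - 1 <= x]
    and the chain collapses.  Equality in the last step makes [F[B]] connected.
    Equality in the first one bounds the degrees in [F[A]] by one: deleting a
    vertex of degree at least two first would save a vertex. *)
Require Import Defs.
From mathcomp Require Import all_boot all_order all_algebra.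
From mathcomp Require Import zify lra.

Set Implicit Arguments.
Unset Strict Implicit.
Unset Printing Implicit Defensive.

Import GRing.Theory Num.Theory.

(** * Edge counts and degree sums *)

Section EdgeCounts.
Variable G : sgraph.
Implicit Types (u v : G) (X S : {set G}) (e : {set G}).

(** Counting inside the ambient graph lets inductions shrink [X] without changing the vertex type;
    [edges_inE] links the count to induced subgraphs. *)
Definition edges_sub X : {set {set G}} := [set e in edges G | e \subset X].

Definition edge_count X : nat := #|edges_sub X|.

Definition neighbours_in X v : {set G} := [set u in X | adj v u].

Lemma edgesP e :
  reflect (exists u v, adj u v /\ e = [set u; v]) (e \in edges G).
Proof.
apply: (iffP imsetP) => [[[u v]] uv ->|[u [v [uv ->]]]].
  by exists u, v.
by exists (u, v).
Qed.

Lemma adj_neq u v : adj u v -> u != v.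
Proof. by move=> uv; apply/eqP => eq_uv; rewrite eq_uv adj_irr in uv. Qed.

Lemma mem_edges u v : ([set u; v] \in edges G) = adj u v.
Proof.
apply/edgesP/idP => [[a [b [ab E]]]|uv]; last by exists u, v.
have nab := adj_neq ab.
have := set21 a b; have := set22 a b; rewrite -E !inE.
move=> /orP[]/eqP Eb /orP[]/eqP Ea; subst => //.
- by rewrite eqxx in nab.
- by rewrite adj_sym.
- by rewrite eqxx in nab.
Qed.

Lemma edges_through v e : e \in edges G -> v \in e ->
  exists2 w, adj v w & e = [set v; w].
Proof.
case/edgesP=> a [b [ab ->]]; rewrite !inE => /orP[]/eqP->.
  by exists b.
by exists a; [rewrite adj_sym | rewrite setUC].
Qed.

Lemma card_edges_through X v : v \in X ->
  #|[set e in edges_sub X | v \in e]| = #|neighbours_in X v|.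
Proof.
move=> vX.
have -> : [set e in edges_sub X | v \in e] =
          [set [set v; w] | w in neighbours_in X v].
  apply/setP => e; rewrite !inE; apply/andP/imsetP.
    case=> /andP[eE eX] ve; have [w vw E] := edges_through eE ve.
    exists w => //; rewrite inE vw andbT.
    by apply: (subsetP eX); rewrite E set22.
  case=> w; rewrite inE => /andP[wX vw] ->.
  by rewrite mem_edges vw subUset !sub1set vX wX set21.
apply: card_in_imset => w w'; rewrite !inE => /andP[_ vw] /andP[_ vw'] E.
have := set22 v w; rewrite E !inE (eq_sym w) (negPf (adj_neq vw)).
by move/eqP.
Qed.

Lemma card_edges_subD1 X v : v \in X ->
  edge_count X = edge_count (X :\ v) + #|neighbours_in X v|.
Proof.
move=> vX; rewrite /edge_count -card_edges_through //.
rewrite -(cardsID [set e : {set G} | v \in e] (edges_sub X)) addnC.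
congr (_ + _).
  by apply: eq_card => e; rewrite !inE subsetD1 andbC -andbA.
by apply: eq_card => e; rewrite !inE.
Qed.

Lemma num_edges_setT : num_edges G = edge_count setT.
Proof. by apply: eq_card => e; rewrite !inE subsetT andbT. Qed.

Lemma degreeE v : degree v = #|[set e in edges G | v \in e]|.
Proof.
have -> : [set e in edges G | v \in e] = [set e in edges_sub setT | v \in e].
  by apply/setP => e; rewrite !inE subsetT andbT.
by rewrite card_edges_through ?inE //; apply: eq_card => u; rewrite !inE.
Qed.

Lemma card_edge e : e \in edges G -> #|e| = 2.
Proof. by case/edgesP=> u [v [uv ->]]; rewrite cards2 adj_neq. Qed.

Lemma sum_degree_edges X :
  \sum_(v in X) degree v = \sum_(e in edges G) \sum_(v in e) (v \in X).
Proof.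
transitivity (\sum_(v in X) \sum_(e in edges G) (v \in e)).
  apply: eq_bigr => v _; rewrite degreeE -sum1_card big_mkcond /=.
  rewrite [RHS]big_mkcond; apply: eq_bigr => e _.
  by rewrite inE; case: (e \in _); case: (v \in e).
rewrite exchange_big /=; apply: eq_bigr => e _.
rewrite big_mkcond [RHS]big_mkcond /=; apply: eq_bigr => v _.
by case: (v \in X); case: (v \in e).
Qed.

(** By double counting it suffices to compare edge by edge: an edge with [k] ends in [X] satisfies
    [k + [k = 0] = 1 + [k = 2]]. Applied to an annihilating [X], this yields
    [edge_count X <= edge_count (~: X)]. *)
Lemma sum_degree_split X :
  \sum_(v in X) degree v + edge_count (~: X) = num_edges G + edge_count X.
Proof.
have countE Y : edge_count Y = \sum_(e in edges G) (e \subset Y).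
  rewrite /edge_count -sum1_card big_mkcond [RHS]big_mkcond.
  apply: eq_bigr => e _.
  by rewrite inE; case: (e \in _); case: (e \subset Y).
rewrite sum_degree_edges !countE /num_edges -sum1_card -!big_split /=.
apply: eq_bigr => e /edgesP[u [v [uv ->]]].
rewrite big_setU1 ?big_set1 ?inE ?adj_neq // !subUset !sub1set !inE.
by case: (u \in X); case: (v \in X).
Qed.

(** * Independent sets against edge counts *)

Lemma independentP S :
  reflect {in S &, forall u v, ~~ adj u v} (independent S).
Proof.
by apply: (iffP forall_inP) => [h u v uS vS|h u uS];
  [exact: (forall_inP (h u uS)) | apply/forall_inP => v; apply: h].
Qed.

Lemma card_independent S : independent S -> #|S| <= independence_number G.
Proof. exact: (@leq_bigmax_cond _ _ (fun S => #|S|)). Qed.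

(** Deleting a vertex with a neighbour in [X] costs one vertex and at least one edge; once no such
    vertex remains, the set is independent. *)
Lemma card_le_independence_edges X :
  #|X| <= independence_number G + edge_count X.
Proof.
have [n le_n] := ubnP #|X|; elim: n X le_n => // n IH X le_n.
case: (pickP [pred u in X | 0 < #|neighbours_in X u|]) => [u /= /andP[uX]|no].
  have cX := cardsD1 u X; rewrite uX in cX; have cE := card_edges_subD1 uX.
  have leX : #|X :\ u| < n by lia.
  by have := IH _ leX; lia.
apply: leq_trans (leq_addr _ _); apply: card_independent.
apply/independentP => u v uX vX; apply/negP => uv.
move: (no u) => /=; rewrite uX /= card_gt0 => /negbFE/eqP/setP/(_ v).
by rewrite !inE vX uv.
Qed.

(** Deleting [u] costs one vertex but at least two edges, so the bound for [X :\ u] leaves slack. *)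
Lemma independence_edges_degree_gt1 X u : u \in X ->
  1 < #|neighbours_in X u| -> #|X| < independence_number G + edge_count X.
Proof.
move=> uX; have := card_le_independence_edges (X :\ u).
by have := card_edges_subD1 uX; have := cardsD1 u X; rewrite uX; lia.
Qed.

(** * Leaves, edge bounds and matchings in forests *)

Section Forest.
Hypothesis G_forest : is_forest G.

(** If every vertex of [X] had two neighbours in [X], paths could be extended forever. *)
Lemma forest_leaf X : X != set0 ->
  exists2 v, v \in X & #|neighbours_in X v| <= 1.
Proof.
move=> /set0Pn[x0 x0X].
case: (pickP [pred v in X | #|neighbours_in X v| <= 1]) => [v /andP[]|no].
  by exists v.
have branch v : v \in X -> 1 < #|neighbours_in X v|.
  by move=> vX; have := no v; rewrite /= vX /= ltnNge => ->.
(* Paths grow at the front: [x] is the newest vertex and [head x p] the one before it. *)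
have long n : exists x p,
    [/\ size p = n, x \in X, path (@adj G) x p & uniq (x :: p)].
  elim: n => [|n [x [p [sz xX px up]]]]; first by exists x0, [::].
  (* For [p = [::]] the default [x] of [head] excludes nothing, as [x] is not
     its own neighbour. *)
  have /set0Pn[z] : neighbours_in X x :\ head x p != set0.
    have := branch x xX; rewrite (cardsD1 (head x p)) -card_gt0.
    by case: (_ \in _) => //=; lia.
  rewrite !inE => /and3P[zh zX xz].
  have zp : z \notin p.
    apply/negP => zp; case/path.splitP: zp zh px up => p1 p2 zh.
    rewrite cat_path -cat_cons cat_uniq => /andP[p1z _] /and3P[u1 _ _].
    (* The path from [x] to a repeated [z] closes up by the edge [z x]; as [z] differs from
       [head x p], [p1] is nonempty and the cycle has size at least 3. *)
    apply: (@G_forest (x :: rcons p1 z)).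
      by case: p1 zh {p1z u1}; rewrite //= ?eqxx // => *; rewrite size_rcons.
    by rewrite /ucycle /= rcons_path p1z last_rcons adj_sym xz.
  exists z, (x :: p); split => //=; first by rewrite sz.
    by rewrite adj_sym xz.
  by move: up; rewrite /= inE negb_or zp eq_sym (adj_neq xz).
have [x [p [sz _ _ up]]] := long #|G|.
by have := max_card (mem (x :: p)); rewrite (card_uniqP up) /= sz ltnn.
Qed.

(** Deleting a leaf removes one vertex and at most one edge. The singleton case is separate, as the
    bound fails for the empty set. *)
Lemma forest_edges_sub X : X != set0 -> edge_count X < #|X|.
Proof.
have [n le_n] := ubnP #|X|; elim: n X le_n => // n IH X le_n X0.
have [v vX lv] := forest_leaf X0.
have := card_edges_subD1 vX; have := cardsD1 v X; rewrite vX.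
have [E|Xv] := eqVneq (X :\ v) set0; last by have := IH (X :\ v) _ Xv; lia.
suff: #|neighbours_in X v| = 0 /\ edge_count (X :\ v) = 0 by lia.
split; apply/eqP; rewrite cards_eq0; apply/eqP/setP => w; rewrite !inE.
  apply/negP => /andP[wX vw]; move/setP/(_ w): E.
  by rewrite !inE wX eq_sym (adj_neq vw).
apply/negP; rewrite E subset0 => /andP[wE /eqP w0].
by have := card_edge wE; rewrite w0 cards0.
Qed.

(** Greedy on leaves: a leaf [v] joins [S], and if it has a neighbour [u] in [X], the edge [vu]
    joins [M] and [u] is deleted as well. Each deleted vertex is paid for by one new element of [S]
    or [M]. *)
Lemma forest_independent_matching X : exists S (M : {set {set G}}),
  [/\ S \subset X, independent S, M \subset edges_sub X, trivIset M &
      #|X| <= #|S| + #|M|].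
Proof.
have [n le_n] := ubnP #|X|; elim: n X le_n => // n IH X le_n.
have [->|X0] := eqVneq X set0.
  exists set0, set0; rewrite !sub0set cards0; split => //.
    by apply/independentP => u v; rewrite inE.
  by apply/trivIsetP => e f; rewrite inE.
have [v vX lv] := forest_leaf X0.
(* [Y] is what remains after the deletion: [X :\ v] or [X :\ v :\ u]. *)
have grow (Y S : {set G}) :
    v \notin Y -> {in Y, forall w, w \in X /\ ~~ adj v w} ->
    S \subset Y -> independent S ->
    [/\ v |: S \subset X, independent (v |: S) & #|v |: S| = #|S|.+1].
  move=> vY YX /subsetP SY /independentP iS; split.
  - rewrite subUset sub1set vX; apply/subsetP => w /SY wY.
    by case: (YX w wY).
  - have nv w : w \in S -> ~~ adj v w by move=> /SY wY; case: (YX w wY).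
    apply/independentP => a b; rewrite !inE.
    move=> /orP[/eqP->|aS] /orP[/eqP->|bS]; rewrite ?adj_irr //.
    + exact: nv.
    + by rewrite adj_sym nv.
    + exact: iS.
  - by rewrite cardsU1 (contra (SY v)).
have [N0|[u Nu]] : neighbours_in X v = set0 \/
    exists u, neighbours_in X v = [set u].
  case: (posnP #|neighbours_in X v|) => [/eqP|N1].
    by rewrite cards_eq0; left; apply/eqP.
  by right; apply/cards1P; rewrite eqn_leq lv.
- have cX := cardsD1 v X; rewrite vX in cX.
  have [|S [M [SX iS MX tM le]]] := IH (X :\ v); first by lia.
  have [|w|SX' iS' cS] := grow _ S _ _ SX iS; rewrite ?setD11 //.
    rewrite !inE => /andP[_ wX]; split=> //; apply/negP => vw.
    by move/setP/(_ w): N0; rewrite !inE wX vw.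
  exists (v |: S), M; split => //; last by lia.
  apply: subset_trans MX _; apply/subsetP => e; rewrite !inE => /andP[-> /=].
  by move=> /subset_trans->//; apply: subD1set.
- have /[!inE]/andP[uX vu] : u \in neighbours_in X v by rewrite Nu set11.
  have cX := cardsD1 v X; rewrite vX in cX.
  have cX' := cardsD1 u (X :\ v); rewrite !inE uX eq_sym (adj_neq vu) /= in cX'.
  have [|S [M [SX iS MX tM le]]] := IH (X :\ v :\ u); first by lia.
  have [|w|SX' iS' cS] := grow _ S _ _ SX iS; first by rewrite !inE eqxx andbF.
    rewrite !inE => /and3P[wu _ wX]; split=> //; apply/negP => vw.
    by move/setP/(_ w): Nu; rewrite !inE wX vw (negPf wu).
  have Msub e : e \in M -> e \in edges G /\ e \subset X :\ v :\ u.
    by move=> /(subsetP MX); rewrite inE => /andP[].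
  have [||tM' nM] := @trivIsetU1 _ [set v; u] M _ tM.
  + move=> e /Msub[_]; rewrite !subsetD1 => /andP[/andP[_ ve] ue].
    rewrite disjoint_sym; apply/pred0P => w /=; rewrite !inE.
    by apply/negP => /andP[we /orP[]/eqP E]; rewrite -E we in ve ue.
  + by apply/negP => /Msub[/card_edge]; rewrite cards0.
  exists (v |: S), ([set v; u] |: M); split=> //; last first.
    by rewrite cS cardsU1 nM; lia.
  rewrite subUset sub1set inE mem_edges vu subUset !sub1set vX uX /=.
  apply/subsetP => e /Msub[eE eX]; rewrite inE eE (subset_trans eX) //.
  by apply: subset_trans (subD1set _ _) (subD1set _ _).
Qed.

(** This is the nontrivial half of the identity [alpha + mu = |V|] for bipartite graphs. *)
Lemma forest_card_le : #|G| <= independence_number G + matching_number G.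
Proof.
have [S [M [_ iS MX tM]]] := forest_independent_matching setT.
rewrite cardsT => /leq_trans; apply.
apply: leq_add; first exact: card_independent.
apply: (@leq_bigmax_cond _ _ (fun M : {set {set G}} => #|M|)).
rewrite /is_matching tM andbT; apply: subset_trans MX _.
by apply/subsetP => e; rewrite inE => /andP[].
Qed.

(** No edge leaves the component [C] of [u]. If its complement were nonempty, the forest bound on
    both sides would allow at most [#|G| - 2] edges. *)
Lemma forest_connected : (num_edges G).+1 = #|G| -> is_connected G.
Proof.
move=> cG; split=> [|u v]; first by rewrite -cG.
pose C := [set w | connect (@adj G) u w].
have cC := cardsC C.
have split_edges : num_edges G <= edge_count C + edge_count (~: C).
  apply: leq_trans (leq_card_setU _ _); apply: subset_leq_card.
  apply/subsetP => e eE; rewrite !inE eE /=.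
  case/edgesP: eE => a [b [ab ->]]; rewrite !subUset !sub1set !inE.
  have -> : connect (@adj G) u b = connect (@adj G) u a.
    apply/idP/idP => /connect_trans; apply; apply: connect1 => //.
    by rewrite adj_sym.
  by case: (connect _ u a).
have C0 : C != set0 by apply/set0Pn; exists u; rewrite inE.
have := forest_edges_sub C0.
have [/setP/(_ v)|/forest_edges_sub] := eqVneq (~: C) set0; last by lia.
by rewrite !inE => /negbFE.
Qed.

End Forest.

(** * Graphs of maximum degree one *)

Lemma max_degree1_matching : (forall v : G, degree v <= 1) ->
  exists n, isomorphic G (matching_graph (num_edges G) n).
Proof.
move=> deg1.
have uniq_nb v a b : adj v a -> adj v b -> a = b.
  move=> va vb; have /cards1P[w E] : #|[set u | adj v u]| == 1.
    by rewrite eqn_leq deg1 card_gt0; apply/set0Pn; exists a; rewrite inE.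
  have /[!inE]/eqP-> : a \in [set w] by rewrite -E inE.
  by have /[!inE]/eqP-> : b \in [set w] by rewrite -E inE.
pose I := [set v : G | [forall u, ~~ adj v u]].
exists #|I|.
have /fin_all_exists[ends endsP] (i : 'I_(num_edges G)) :
    exists p : G * G, adj p.1 p.2 /\ enum_val i = [set p.1; p.2].
  by have /edgesP[a [b ab]] := enum_valP i; exists (a, b).
(* The chosen ordering of each edge matches the boolean of the model graph; [endpoint i (~~ b)] is
   the only neighbour of [endpoint i b]. *)
pose endpoint i (b : bool) := if b then (ends i).1 else (ends i).2.
have adj_endpoint i b : adj (endpoint i b) (endpoint i (~~ b)).
  by case: (endsP i) b => ab _ [] //=; rewrite adj_sym.
(* Both orders of the endpoints are allowed, so later steps may start from either end. *)
have edge_endpoint i b : enum_val i = [set endpoint i b; endpoint i (~~ b)].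
  by case: (endsP i) b => _ -> [] //=; rewrite setUC.
have endpoint_inj i b j c : endpoint i b = endpoint j c -> i = j /\ b = c.
  move=> E; have E' : endpoint i (~~ b) = endpoint j (~~ c).
    by apply: (uniq_nb (endpoint i b)); rewrite // E.
  have ij : i = j.
    apply: enum_val_inj.
    by rewrite (edge_endpoint i b) (edge_endpoint j c) E E'.
  split=> //; subst j; apply/eqP; apply/negPn/negP => nbc.
  have := adj_endpoint i b; rewrite E.
  have -> : ~~ b = c by case: (b) (c) nbc => [] [].
  by rewrite adj_irr.
pose g (t : matching_graph (num_edges G) #|I|) : G :=
  match t with inl (i, b) => endpoint i b | inr j => enum_val j end.
have isolated (j : 'I_#|I|) v : adj (enum_val j) v = false.
  by have := enum_valP j; rewrite inE => /forallP/(_ v)/negPf.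
have g_inj : injective g.
  move=> [[i b]|i] [[j c]|j] /= E.
  - by have [-> ->] := endpoint_inj _ _ _ _ E.
  - by have := adj_endpoint i b; rewrite E isolated.
  - by have := adj_endpoint j c; rewrite -E isolated.
  - by rewrite (enum_val_inj E).
have g_surj v : v \in codom g.
  have [vI|] := boolP (v \in I).
    apply/codomP; exists (inr (enum_rank_in vI v)).
    by rewrite /= enum_rankK_in.
  rewrite inE => /forallPn[u /negPn vu].
  have eE : [set v; u] \in edges G by rewrite mem_edges.
  pose i := enum_rank_in eE [set v; u].
  have Ei : enum_val i = [set v; u] by rewrite enum_rankK_in.
  have : v \in enum_val i by rewrite Ei set21.
  rewrite (edge_endpoint i true) !inE => /orP[]/eqP->; apply/codomP.
    by exists (inl (i, true)).
  by exists (inl (i, false)).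
have g_adj s t : adj (g s) (g t) = adj s t.
  case: s => [[i b]|i]; last by rewrite isolated.
  case: t => [[j c]|j]; last by rewrite adj_sym isolated.
  apply/idP/andP => /= [E|[/eqP<- nbc]].
    have [-> <-] := endpoint_inj _ _ _ _ (uniq_nb _ _ _ (adj_endpoint i b) E).
    by rewrite eqxx; case: (b).
  by have := adj_endpoint i b; congr adj; case: (b) (c) nbc => [] [].
(* [g] runs from the model to [G]; the required isomorphism is its inverse. *)
have [f gK fK] : bijective g.
  apply: inj_card_bij g_inj _; apply: leq_trans (leq_image_card g _).
  by apply: subset_leq_card; apply/subsetP => v _; apply: g_surj.
exists f; first by exists g.
by move=> u v; rewrite -g_adj !fK.
Qed.

End EdgeCounts.

(** * Transfer to induced subgraphs *)

Section InducedSubgraph.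
Variables (G : sgraph) (X : {set G}).

Lemma edges_inE : edges_in X = edge_count X.
Proof.
rewrite /edges_in /num_edges
  -(card_imset _ (imset_inj (@val_inj _ _ {v : G | v \in X}))).
apply: eq_card => e; rewrite inE; apply/imsetP/andP.
  case=> _ /edgesP[u [v [uv ->]]] ->; rewrite imsetU1 imset_set1.
  by rewrite mem_edges subUset !sub1set (valP u) (valP v).
case=> /edgesP[u [v [uv ->]]]; rewrite subUset !sub1set => /andP[uX vX].
exists [set (exist _ u uX : induced X); exist _ v vX].
  by apply/edgesP; exists (exist _ u uX), (exist _ v vX).
by rewrite imsetU1 imset_set1.
Qed.

Lemma card_induced : #|induced X| = #|X|.
Proof. by rewrite card_sig. Qed.

Lemma induced_forest : is_forest G -> is_forest (induced X).
Proof.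
move=> fG c sc /andP[cc uc]; apply: (fG (map val c)); first by rewrite size_map.
rewrite /ucycle (map_inj_uniq val_inj) uc andbT.
by case: c cc {sc uc} => //= x p; rewrite -map_rcons path_map.
Qed.

Lemma degree_induced (v : induced X) : degree v = #|neighbours_in X (val v)|.
Proof.
rewrite /degree -(card_imset _ val_inj); apply: eq_card => u.
apply/imsetP/idP => [[w]|]; rewrite !inE.
  by move=> vw ->; apply/andP; split; [exact: valP | exact: vw].
by case/andP=> uX vu; exists (exist _ u uX); rewrite ?inE.
Qed.

End InducedSubgraph.

(** * Collapse of the chain of inequalities *)

Local Open Scope ring_scope.

Theorem proposition3p2 (F : sgraph) (A B : {set F}) (x : rat)
    (F_forest : is_forest F)
    (F_edge : (0 < num_edges F)%N)
    (AB_decomp : annihilating_decomposition A B)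
    (x_def : x = (annihilation_number F)%:R - (independence_number F)%:R)
    (x_eq : x = ((matching_number F)%:R - 1) / 2%:R) :
  [/\ odd (matching_number F),
      [/\ x = (edges_in A)%:R,
          (edges_in A)%:R = (edges_in B)%:R :> rat &
          (edges_in B)%:R = (#|B|)%:R - 1 :> rat],
      is_tree (induced B) &
      exists k n : nat,
        x = k%:R /\ isomorphic (induced A) (matching_graph k n)].
Proof.
case: AB_decomp => annA cardA defB.
have degA := sum_degree_split A; rewrite /annihilating in annA.
have cardAB := cardsC A.
have B0 : B != set0.
  apply/eqP => B0; have AT : A = setT by rewrite -[A]setCK -defB B0 setC0.
  (* The empty set gives [edge_count set0 = 0]; so if [A] were everything, its degree sum would be
     twice the number of edges, too large since there is an edge. *)
  have := sum_degree_split (set0 : {set F}); rewrite big_set0 setC0.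
  by move: degA annA; rewrite -defB B0 AT -num_edges_setT; lia.
have eB := forest_edges_sub F_forest B0.
have eA := card_le_independence_edges A.
have konig := forest_card_le F_forest.
rewrite -defB in degA cardAB.
(* Clearing the denominator and moving the negative terms across turns the hypothesis into an
   equation over [nat]. *)
have x_nat : (2 * annihilation_number F + 1 =
              matching_number F + 2 * independence_number F)%N.
  apply/eqP; rewrite -(eqr_nat rat) !natrD; apply/eqP.
  by move: x_eq; rewrite x_def; lra.
(* With [konig], [x_nat] gives [#|B| - 1 <= a - alpha], while [eA], [degA] with [annA], and [eB]
   give [a - alpha <= e(A) <= e(B) <= #|B| - 1]. *)
have eAB : edge_count A = edge_count B by lia.
have eB1 : #|B| = (edge_count B).+1 by lia.
have aE : annihilation_number F = (independence_number F + edge_count A)%N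
  by lia.
have muE : matching_number F = (2 * edge_count A).+1 by lia.
have xE : x = (edges_in A)%:R by rewrite x_def aE edges_inE natrD; lra.
split.
- by rewrite muE /= oddM.
- by rewrite xE !edges_inE eB1 eAB -natr1; split=> //; lra.
- have fB := induced_forest (X := B) F_forest; split=> //.
  by apply: forest_connected => //; rewrite card_induced eB1 -edges_inE.
(* A vertex of degree above one in [F[A]] would make [eA] strict, against [aE]. *)
- have [|n iso] := @max_degree1_matching (induced A).
    move=> v; rewrite degree_induced leqNgt; apply/negP.
    by move/(independence_edges_degree_gt1 (valP v)); lia.
  by exists (edges_in A), n.
Qed.
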